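(* The concept satisfiability problem for $\mathcal{ALC}\mathsf{Self}_{\mathsf{vpl}}$ is undecidable. This holds even if every language occurring in the input concept is either regular or is a visibly-pushdown encoding (in the sense described in the context) of the language of a deterministic one-counter automaton.
   Context: Fix countably infinite pairwise disjoint sets of individual names, concept names and role names. An interpretation $\mathcal{I}=(\Delta^{\mathcal{I}},\cdot^{\mathcal{I}})$ has a non-empty domain and maps concept names to subsets of $\Delta^{\mathcal{I}}$ and role names to binary relations on $\Delta^{\mathcal{I}}$. The role names are partitioned into call, internal and return role names; the pushdown alphabet is (call role names, internal role names together with all test letters $A?$ for concept names $A$, return role names). A path is a finite non-empty sequence of domain elements $\rho_1\dots\rho_{n+1}$; it is an $\mathcal{L}$-path for a language $\mathcal{L}$ of finite words over finitely many such letters if some word $w_1\dots w_n\in\mathcal{L}$ satisfies, for every $i\le n$, either $w_i$ is a role name and $(\rho_i,\rho_{i+1})\in w_i^{\mathcal{I}}$, or $w_i=A?$, $\rho_i=\rho_{i+1}$ and $\rho_i\in A^{\mathcal{I}}$. An element $e$ is $\mathcal{L}$-reachable from $d$ if some $\mathcal{L}$-path starts at $d$ and ends at $e$. Concepts of $\mathcal{ALC}_{\mathsf{vpl}}$ are built from $\top$, concept names, $\neg$, $\sqcap$, $\exists r.C$ ($r$ a role name) and $\exists\mathcal{L}.C$ where $\mathcal{L}$ is a visibly-pushdown language over a finite subset of the pushdown alphabet, given by a nondeterministic visibly-pushdown automaton; $(\exists\mathcal{L}.C)^{\mathcal{I}}$ is the set of elements that can $\mathcal{L}$-reach an element of $C^{\mathcal{I}}$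 (and $\forall \mathcal{L}.C:=\neg\exists\mathcal{L}.\neg C$). $\mathcal{ALC}\mathsf{Self}_{\mathsf{vpl}}$ additionally allows concepts $\exists r.\mathsf{Self}$ with $(\exists r.\mathsf{Self})^{\mathcal{I}}=\{d\mid (d,d)\in r^{\mathcal{I}}\}$. The concept satisfiability problem asks, given a concept $C$, whether there is an interpretation with $C^{\mathcal{I}}\neq\emptyset$. A deterministic one-counter automaton (DOCA) is a deterministic pushdown automaton whose stack alphabet has a single letter besides the bottom symbol. For a DOCA $\mathcal{A}$ over a finite alphabet $\Sigma$, a visibly-pushdown encoding of its language is a visibly-pushdown language over the pushdown alphabet $(\Sigma\times\{c\}, (\Sigma\times\{i\})\cup\{\mathtt{x}\}, \Sigma\times\{r\})$ (letters identified with role names of the corresponding kind, $\mathtt{x}$ a fresh internal letter) all of whose words have the form $\tilde a_1\mathtt{x}\tilde a_2\mathtt{x}\cdots\mathtt{x}\tilde a_n$ with $\tilde a_j\in\Sigma\times\{c,i,r\}$, such that $L(\mathcal{A})$ equals the set of first-coordinate projections $\pi_1(\tilde a_1)\cdots\pi_1(\tilde a_n)$ of such words. *)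

(* Defs.v *)
(* Undecidability of concept satisfiability for ALCSelf_vpl.
   Computability is made explicit via the weak call-by-value lambda calculus L
   (Forster-Smolka style): a problem is decidable iff some L-term decides it on
   the (Scott-)encoded inputs. *)
From Stdlib Require Import List Arith.
Import ListNotations.

Inductive rkind : Type := Call | Int | Ret.

Definition role : Type := (rkind * nat)%type.

Inductive Letter : Type :=
| LRole : role -> Letter
| LTest : nat -> Letter.

Definition lkind (a : Letter) : rkind :=
  match a with LRole (k, _) => k | LTest _ => Int end.

Record vpa : Type := {
  valph  : list Letter;
  vinit  : list nat;
  vfinal : list nat;
  vcall  : list (nat * Letter * nat * nat);       (* q, a, q', pushed symbol *)
  vint   : list (nat * Letter * nat);
  vret   : list (nat * Letter * option nat * nat) (* q, a, popped symbol or bottom, q' *)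
}.

Inductive vstep (A : vpa) : Letter -> nat * list nat -> nat * list nat -> Prop :=
| vs_call a q q' g st : lkind a = Call -> In (q, a, q', g) (vcall A) ->
    vstep A a (q, st) (q', g :: st)
| vs_int a q q' st : lkind a = Int -> In (q, a, q') (vint A) ->
    vstep A a (q, st) (q', st)
| vs_ret a q q' g st : lkind a = Ret -> In (q, a, Some g, q') (vret A) ->
    vstep A a (q, g :: st) (q', st)
| vs_retb a q q' : lkind a = Ret -> In (q, a, None, q') (vret A) ->
    vstep A a (q, []) (q', []).

Inductive vrun (A : vpa) : list Letter -> nat * list nat -> nat * list nat -> Prop :=
| vr_nil c : vrun A [] c c
| vr_cons a w c c' c'' : vstep A a c c' -> vrun A w c' c'' -> vrun A (a :: w) c c''.

Definition vlang (A : vpa) (w : list Letter) : Prop :=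
  Forall (fun a => In a (valph A)) w /\
  exists q0 qf st, In q0 (vinit A) /\ In qf (vfinal A) /\ vrun A w (q0, []) (qf, st).

Inductive concept : Type :=
| CTop  : concept
| CName : nat -> concept
| CNeg  : concept -> concept
| CAnd  : concept -> concept -> concept
| CEx   : role -> concept -> concept
| CExL  : vpa -> concept -> concept
| CSelf : role -> concept.

Record interp : Type := {
  dom  : Type;
  dom_elt : dom;
  cint : nat -> dom -> Prop;
  rint : role -> dom -> dom -> Prop
}.

Definition lstep (I : interp) (a : Letter) (d e : dom I) : Prop :=
  match a with
  | LRole r => rint I r d e
  | LTest A => d = e /\ cint I A d
  end.

Inductive lpath (I : interp) : list Letter -> dom I -> dom I -> Prop :=
| lp_nil d : lpath I [] d d
| lp_cons a w d d' e : lstep I a d d' -> lpath I w d' e -> lpath I (a :: w) d e.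

Fixpoint sem (I : interp) (C : concept) : dom I -> Prop :=
  match C with
  | CTop => fun _ => True
  | CName A => cint I A
  | CNeg C => fun d => ~ sem I C d
  | CAnd C D => fun d => sem I C d /\ sem I D d
  | CEx r C => fun d => exists e, rint I r d e /\ sem I C e
  | CExL A C => fun d => exists e w, vlang A w /\ lpath I w d e /\ sem I C e
  | CSelf r => fun d => rint I r d d
  end.

Definition satisfiable (C : concept) : Prop := exists (I : interp) (d : dom I), sem I C d.

Fixpoint langs (C : concept) : list vpa :=
  match C with
  | CTop | CName _ | CSelf _ => []
  | CNeg C => langs C
  | CAnd C D => langs C ++ langs D
  | CEx _ C => langs C
  | CExL A C => A :: langs C
  end.

Record nfa : Type := {
  ninit : list nat; nfinal : list nat; ntrans : list (nat * Letter * nat) }.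

Inductive nrun (N : nfa) : list Letter -> nat -> nat -> Prop :=
| nr_nil q : nrun N [] q q
| nr_cons a w q q' q'' : In (q, a, q') (ntrans N) -> nrun N w q' q'' -> nrun N (a :: w) q q''.

Definition nlang (N : nfa) (w : list Letter) : Prop :=
  exists q0 qf, In q0 (ninit N) /\ In qf (nfinal N) /\ nrun N w q0 qf.

Definition is_regular (L : list Letter -> Prop) : Prop :=
  exists N : nfa, forall w, L w <-> nlang N w.

(* DOCA: a deterministic pushdown automaton with stack alphabet {Z} plus the
   bottom symbol; the stack bot Z^n is represented by the counter n.
   A transition (q, [a], topIsZ, q', k) replaces the top symbol: if the top is
   bottom, it is replaced by bot Z^k; if the top is Z, it is replaced by Z^k.
   Epsilon-transitions are allowed (deterministic). Input letters are nat. *)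
Record doca : Type := {
  dsig   : list nat;
  dinit  : nat;
  dfinal : list nat;
  deps   : list (nat * bool * nat * nat);       (* q, topIsZ, q', k *)
  dtr    : list (nat * nat * bool * nat * nat)  (* q, a, topIsZ, q', k *)
}.

Definition cupd (n k : nat) : nat := if n =? 0 then k else n - 1 + k.

Inductive dstep (A : doca) : option nat -> nat * nat -> nat * nat -> Prop :=
| ds_eps q n q' k : In (q, negb (n =? 0), q', k) (deps A) ->
    dstep A None (q, n) (q', cupd n k)
| ds_let q a n q' k : In (q, a, negb (n =? 0), q', k) (dtr A) ->
    dstep A (Some a) (q, n) (q', cupd n k).

Inductive drun (A : doca) : list nat -> nat * nat -> nat * nat -> Prop :=
| dr_nil c : drun A [] c c
| dr_eps w c c' c'' : dstep A None c c' -> drun A w c' c'' -> drun A w c c''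
| dr_let a w c c' c'' : dstep A (Some a) c c' -> drun A w c' c'' -> drun A (a :: w) c c''.

Definition deterministic (A : doca) : Prop :=
  (forall q z q1 k1 q2 k2,
      In (q, z, q1, k1) (deps A) -> In (q, z, q2, k2) (deps A) -> q1 = q2 /\ k1 = k2) /\
  (forall q a z q1 k1 q2 k2,
      In (q, a, z, q1, k1) (dtr A) -> In (q, a, z, q2, k2) (dtr A) -> q1 = q2 /\ k1 = k2) /\
  (forall q z q1 k1 a q2 k2,
      In (q, z, q1, k1) (deps A) -> ~ In (q, a, z, q2, k2) (dtr A)).

Definition dlang (A : doca) (u : list nat) : Prop :=
  Forall (fun a => In a (dsig A)) u /\
  exists qf n, In qf (dfinal A) /\ drun A u (dinit A, 0) (qf, n).

Definition interleave (x : Letter) (w : list Letter) : list Letter :=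
  match w with
  | [] => []
  | a :: rest => a :: flat_map (fun b => [x; b]) rest
  end.

Definition inj_on (S : list nat) (f : nat -> nat) : Prop :=
  forall a b, In a S -> In b S -> f a = f b -> a = b.

(* L is a visibly-pushdown encoding of the language of some DOCA: the letters
   Sigma x {c,i,r} are identified (injectively, kind-preservingly) with role
   names via fc, fi, fr, and x is a fresh internal letter. *)
Definition is_doca_vpe (L : list Letter -> Prop) : Prop :=
  exists (A : doca) (fc fi fr : nat -> nat) (x : Letter),
    deterministic A /\
    inj_on (dsig A) fc /\ inj_on (dsig A) fi /\ inj_on (dsig A) fr /\
    lkind x = Int /\ (forall a, In a (dsig A) -> x <> LRole (Int, fi a)) /\
    let iota := fun p : nat * rkind =>
      match snd p with
      | Call => LRole (Call, fc (fst p))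
      | Int  => LRole (Int, fi (fst p))
      | Ret  => LRole (Ret, fr (fst p))
      end in
    (forall w, L w -> exists ws : list (nat * rkind),
        Forall (fun p => In (fst p) (dsig A)) ws /\ w = interleave x (map iota ws)) /\
    (forall u, dlang A u <-> exists ws : list (nat * rkind),
        Forall (fun p => In (fst p) (dsig A)) ws /\
        L (interleave x (map iota ws)) /\ map fst ws = u).

Definition in_fragment (C : concept) : Prop :=
  forall A, In A (langs C) -> is_regular (vlang A) \/ is_doca_vpe (vlang A).

Inductive term : Type :=
| var : nat -> term
| app : term -> term -> term
| lam : term -> term.

Fixpoint subst (s : term) (k : nat) (u : term) : term :=
  match s with
  | var n => if Nat.eqb n k then u else var n
  | app s t => app (subst s k u) (subst t k u)
  | lam s => lam (subst s (S k) u)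
  end.

Inductive step : term -> term -> Prop :=
| stepBeta s t : step (app (lam s) (lam t)) (subst s 0 (lam t))
| stepAppL s s' t : step s s' -> step (app s t) (app s' t)
| stepAppR s t t' : step t t' -> step (app s t) (app s t').

Inductive star : term -> term -> Prop :=
| star_refl s : star s s
| star_step s s' t : step s s' -> star s' t -> star s t.

Definition ltrue : term := lam (lam (var 1)).
Definition lfalse : term := lam (lam (var 0)).

Inductive tree : Type := Node : nat -> list tree -> tree.

Fixpoint nenc (n : nat) : term :=
  match n with
  | O => lam (lam (var 1))
  | S n => lam (lam (app (var 0) (nenc n)))
  end.

Fixpoint tenc (t : tree) : term :=
  match t with
  | Node n ts =>
      lam (app (app (var 0) (nenc n))
        ((fix lenc (l : list tree) : term :=
            match l with
            | [] => lam (lam (var 1))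
            | t :: l => lam (lam (app (app (var 0) (tenc t)) (lenc l)))
            end) ts))
  end.

Definition tnat (n : nat) : tree := Node n [].
Definition tkind (k : rkind) : tree :=
  match k with Call => tnat 0 | Int => tnat 1 | Ret => tnat 2 end.
Definition trole (r : role) : tree := Node 0 [tkind (fst r); tnat (snd r)].
Definition tletter (a : Letter) : tree :=
  match a with LRole r => Node 0 [trole r] | LTest A => Node 1 [tnat A] end.
Definition topt (o : option nat) : tree :=
  match o with None => Node 0 [] | Some g => Node 1 [tnat g] end.
Definition tvpa (A : vpa) : tree :=
  Node 0 [ Node 0 (map tletter (valph A));
           Node 0 (map tnat (vinit A));
           Node 0 (map tnat (vfinal A));
           Node 0 (map (fun '(q, a, q', g) => Node 0 [tnat q; tletter a; tnat q'; tnat g]) (vcall A));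
           Node 0 (map (fun '(q, a, q') => Node 0 [tnat q; tletter a; tnat q']) (vint A));
           Node 0 (map (fun '(q, a, g, q') => Node 0 [tnat q; tletter a; topt g; tnat q']) (vret A)) ].

Fixpoint tconcept (C : concept) : tree :=
  match C with
  | CTop => Node 0 []
  | CName A => Node 1 [tnat A]
  | CNeg C => Node 2 [tconcept C]
  | CAnd C D => Node 3 [tconcept C; tconcept D]
  | CEx r C => Node 4 [trole r; tconcept C]
  | CExL A C => Node 5 [tvpa A; tconcept C]
  | CSelf r => Node 6 [trole r]
  end.

Definition cenc (C : concept) : term := tenc (tconcept C).

Definition L_decides_on (D P : concept -> Prop) : Prop :=
  exists u : term, forall C, D C ->
    (P C -> star (app u (cenc C)) ltrue) /\ (~ P C -> star (app u (cenc C)) lfalse).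

(* Main.v *)
(* A weak call-by-value evaluator for L is a fixed deterministic program over six stacks. A run is described along a chain of an internal role, each time point carrying self-loops that name the stack operation performed there. The control flow is expressible in ALC with self; that a pop returns the symbol last pushed is expressed by forbidding, for each stack i and symbol a, every path of the form "push a on i, a stretch that is balanced for i, pop b <> a from i". These paths form a one-counter language, whose visibly-pushdown encoding reads the operations of stack i as calls and returns and all others as internal letters. Hence the concept of a run is unsatisfiable if the evaluated term returns true and satisfiable if it returns false. Given a supposed decider u, a recursion-theorem argument yields a term applying u to the concept of its own evaluation, which contradicts the answer of u. *)
From Stdlib Require Import List Arith Lia Cantor FunctionalExtensionality.
Require Import Defs.
Import ListNotations.

(** * One-counter languages and their visibly-pushdown encodings *)

Inductive action : Type := Up | Down (bad : bool) | Stay.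

(** Here [n] counts the unmatched [Up] letters after a distinguished first one. Acceptance happens
    only at the letter that matches this first one, which must be bad and last. *)
Fixpoint acc (cls : nat -> action) (n : nat) (u : list nat) : Prop :=
  match u with
  | [] => False
  | o :: v =>
      match cls o with
      | Up => acc cls (S n) v
      | Down bad => match n with 0 => bad = true /\ v = [] | S m => acc cls m v end
      | Stay => acc cls n v
      end
  end.

Definition kind_of (cls : nat -> action) (o : nat) : rkind :=
  match cls o with Up => Call | Down _ => Ret | Stay => Int end.

Definition letter_of (cls : nat -> action) (o : nat) : Letter :=
  LRole (kind_of cls o, o).

Definition counter_lang (sig : list nat) (s : nat) (cls : nat -> action) (u : list nat) : Prop :=
  Forall (fun o => In o sig) u /\ exists v, u = s :: v /\ acc cls 0 v.

(** State 1 expects the separator, state 2 an operation. The first push writes stack symbol 0 and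
    later ones write 1, so the popped symbol tells whether a return matches the first push. *)
Definition counter_vpa (sig : list nat) (x s : nat) (cls : nat -> action) : vpa := {|
  valph := LRole (Int, x) :: map (letter_of cls) sig;
  vinit := [0];
  vfinal := [3];
  vcall := (0, letter_of cls s, 1, 0) ::
    flat_map (fun o => match cls o with Up => [(2, letter_of cls o, 1, 1)] | _ => [] end) sig;
  vint := (1, LRole (Int, x), 2) ::
    flat_map (fun o => match cls o with Stay => [(2, letter_of cls o, 1)] | _ => [] end) sig;
  vret := flat_map (fun o => match cls o with
      | Down bad => (2, letter_of cls o, Some 1, 1) ::
                    (if bad then [(2, letter_of cls o, Some 0, 3)] else [])
      | _ => [] end) sig |}.

(** A transition replaces the top symbol, so an unchanged counter means writing one [Z] over [Z] but
    none over the bottom. The first push is remembered by the state and leaves the counter at 0. *)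
Definition counter_doca (sig : list nat) (s : nat) (cls : nat -> action) : doca := {|
  dsig := sig;
  dinit := 0;
  dfinal := [2];
  deps := [];
  dtr := (0, s, false, 1, 0) ::
    flat_map (fun o => match cls o with
      | Up => [(1, o, false, 1, 1); (1, o, true, 1, 2)]
      | Down bad => (1, o, true, 1, 0) :: (if bad then [(1, o, false, 2, 0)] else [])
      | Stay => [(1, o, false, 1, 0); (1, o, true, 1, 1)]
      end) sig |}.

Lemma flat_map_sep_inj {A} (x : A) (u v : list A) :
  flat_map (fun b => [x; b]) u = flat_map (fun b => [x; b]) v -> u = v.
Proof.
  revert v; induction u as [|a u IH]; intros [|b v]; cbn; intros H; try discriminate; auto.
  injection H as -> H; f_equal; auto.
Qed.

Lemma interleave_inj (x : Letter) (u v : list Letter) :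
  interleave x u = interleave x v -> u = v.
Proof.
  destruct u as [|a u], v as [|b v]; cbn; intros H; try discriminate; auto.
  injection H as -> H; f_equal; exact (flat_map_sep_inj x u v H).
Qed.

Section Counter.
Variables (sig : list nat) (x s : nat) (cls : nat -> action).
Hypotheses (Hx : ~ In x sig) (Hs : In s sig) (Hup : cls s = Up).

Local Notation A := (counter_vpa sig x s cls).
Local Notation xl := (LRole (Int, x)).
Local Notation sep := (flat_map (fun b => [xl; b])).
Local Notation ol := (letter_of cls).

Lemma vstep_inv a q st c : vstep A a (q, st) c ->
  (q = 0 /\ a = ol s /\ c = (1, 0 :: st)) \/
  (q = 1 /\ a = xl /\ c = (2, st)) \/
  (q = 2 /\ exists o, In o sig /\ a = ol o /\
     match cls o with
     | Up => c = (1, 1 :: st)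
     | Stay => c = (1, st)
     | Down bad => exists g st', st = g :: st' /\
         (g = 1 /\ c = (1, st') \/ g = 0 /\ bad = true /\ c = (3, st'))
     end).
Proof.
  intros H; inversion H as [? ? ? ? ? Hk Hin|? ? ? ? Hk Hin|? ? ? ? ? Hk Hin|? ? ? Hk Hin];
    subst; cbn in Hin.
  - destruct Hin as [E|Hin]; [injection E as <- <- <- <-; auto|].
    apply in_flat_map in Hin as [o [Ho E]].
    destruct (cls o) eqn:Eo; cbn in E; try easy; destruct E as [E|[]]; injection E as <- <- <- <-.
    right; right; split; auto; exists o; rewrite Eo; auto.
  - destruct Hin as [E|Hin]; [injection E as <- <- <-; auto|].
    apply in_flat_map in Hin as [o [Ho E]].
    destruct (cls o) eqn:Eo; cbn in E; try easy; destruct E as [E|[]]; injection E as <- <- <-.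
    right; right; split; auto; exists o; rewrite Eo; auto.
  - apply in_flat_map in Hin as [o [Ho E]].
    destruct (cls o) as [|bad|] eqn:Eo; cbn in E; try easy; destruct E as [E|E].
    + injection E as <- <- <- <-.
      right; right; split; auto; exists o; rewrite Eo; eauto 10.
    + destruct bad; [|easy]. destruct E as [E|[]].
      injection E as <- <- <- <-.
      right; right; split; auto; exists o; rewrite Eo; eauto 10.
  - apply in_flat_map in Hin as [o [Ho E]].
    destruct (cls o) as [|bad|] eqn:Eo; cbn in E; try easy;
      destruct E as [E|E]; try discriminate.
    destruct bad; [|easy]. destruct E as [E|[]]; discriminate.
Qed.

Lemma lkind_letter o : lkind (ol o) = kind_of cls o.
Proof. reflexivity. Qed.

(** The stack is always [n] ones above the 0 of the first push, with [n] the counter of [acc].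
    States 1 and 2 alternate and are treated in one induction. *)
Lemma vrun_sound w : forall q st n stf, vrun A w (q, st) (3, stf) ->
  st = repeat 1 n ++ [0] ->
  match q with
  | 1 => exists u, Forall (fun o => In o sig) u /\ w = sep (map ol u) /\ acc cls n u
  | 2 => exists o u, Forall (fun o => In o sig) (o :: u) /\
           w = ol o :: sep (map ol u) /\ acc cls n (o :: u)
  | _ => True
  end.
Proof.
  induction w as [|a w IH]; intros q st n stf H Hst.
  - inversion H; subst; exact I.
  - inversion H as [|? ? ? [q' st'] ? Hstep Hrun]; subst.
    destruct (vstep_inv _ _ _ _ Hstep) as [(-> & _ & _)|[(-> & -> & E)|(-> & o & Ho & -> & E)]].
    + exact I.
    + injection E as -> ->.
      destruct (IH _ _ n _ Hrun eq_refl) as (o & u & Hu & -> & Hacc).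
      exists (o :: u); auto.
    + cbn [acc]. destruct (cls o) as [|bad|] eqn:Eo.
      * injection E as -> ->.
        destruct (IH _ _ (S n) _ Hrun eq_refl) as (u & Hu & -> & Hacc).
        exists o, u; rewrite Eo; auto.
      * destruct E as (g & st2 & E & [(-> & E2)|(-> & -> & E2)]);
          injection E2 as -> ->.
        -- destruct n as [|n]; [discriminate|]. injection E as E.
           destruct (IH _ _ n _ Hrun (eq_sym E)) as (u & Hu & -> & Hacc).
           exists o, u; rewrite Eo; auto.
        -- destruct n as [|n]; [|discriminate].
           (* State 3 has no outgoing transition. *)
           assert (w = []) as ->.
           { destruct w as [|b w]; auto.
             inversion Hrun as [|? ? ? ? ? Hs3]; subst.
             destruct (vstep_inv _ _ _ _ Hs3) as [(F & _)|[(F & _)|(F & _)]]; discriminate. }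
           exists o, []; rewrite Eo; auto.
      * injection E as -> ->.
        destruct (IH _ _ n _ Hrun eq_refl) as (u & Hu & -> & Hacc).
        exists o, u; rewrite Eo; auto.
Qed.

Lemma vrun_complete u : forall n, Forall (fun o => In o sig) u -> acc cls n u ->
  exists stf, vrun A (sep (map ol u)) (1, repeat 1 n ++ [0]) (3, stf).
Proof.
  induction u as [|o u IH]; cbn; intros n Hu Hacc; [destruct Hacc|].
  inversion Hu as [|? ? Ho Hu']; subst.
  assert (Hxs : forall st, vstep A xl (1, st) (2, st))
    by (intros; apply vs_int; cbn; auto).
  destruct (cls o) as [|bad|] eqn:Eo.
  - destruct (IH (S n) Hu' Hacc) as [stf Hr]. exists stf.
    eapply vr_cons; [apply Hxs|]. eapply vr_cons; [|exact Hr].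
    apply vs_call; [rewrite lkind_letter; unfold kind_of; now rewrite Eo|].
    cbn; right; apply in_flat_map; exists o; rewrite Eo; cbn; auto.
  - destruct n as [|n].
    + destruct Hacc as [-> ->]. exists [].
      eapply vr_cons; [apply Hxs|]. eapply vr_cons; [|apply vr_nil].
      apply vs_ret; [rewrite lkind_letter; unfold kind_of; now rewrite Eo|].
      cbn; apply in_flat_map; exists o; rewrite Eo; cbn; auto.
    + destruct (IH n Hu' Hacc) as [stf Hr]. exists stf.
      eapply vr_cons; [apply Hxs|]. eapply vr_cons; [|exact Hr].
      apply vs_ret; [rewrite lkind_letter; unfold kind_of; now rewrite Eo|].
      cbn; apply in_flat_map; exists o; rewrite Eo; cbn; auto.
  - destruct (IH n Hu' Hacc) as [stf Hr]. exists stf.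
    eapply vr_cons; [apply Hxs|]. eapply vr_cons; [|exact Hr].
    apply vs_int; [rewrite lkind_letter; unfold kind_of; now rewrite Eo|].
    cbn; right; apply in_flat_map; exists o; rewrite Eo; cbn; auto.
Qed.

Lemma counter_vpa_spec w : vlang A w <->
  exists u, counter_lang sig s cls u /\ w = interleave xl (map ol u).
Proof.
  split.
  - intros [_ (q0 & qf & st & [<-|[]] & [<-|[]] & Hr)].
    inversion Hr as [|? ? ? [q' st'] ? Hstep Hrun]; subst.
    destruct (vstep_inv _ _ _ _ Hstep) as [(_ & -> & E)|[(F & _)|(F & _)]]; try discriminate.
    injection E as -> ->.
    destruct (vrun_sound _ _ _ 0 _ Hrun eq_refl) as (u & Hu & -> & Hacc).
    exists (s :: u); split; [split; eauto|reflexivity].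
  - intros (u & [Hu (v & -> & Hacc)] & ->). inversion Hu as [|? ? _ Hv]; subst.
    split.
    + cbn; constructor; [right; apply in_map; auto|].
      apply Forall_forall; intros a Ha. apply in_flat_map in Ha as (b & Hb & [<-|[<-|[]]]).
      * left; reflexivity.
      * right. apply in_map_iff in Hb as (o & <- & Ho). apply in_map.
        rewrite Forall_forall in Hv; auto.
    + destruct (vrun_complete v 0 Hv Hacc) as [stf Hr].
      exists 0, 3, stf; cbn; repeat split; auto.
      eapply vr_cons; [|exact Hr].
      apply vs_call; [rewrite lkind_letter; unfold kind_of; now rewrite Hup|cbn; auto].
Qed.

Local Notation D := (counter_doca sig s cls).

Lemma dtr_inv q a z q' k : In (q, a, z, q', k) (dtr D) ->
  (q = 0 /\ a = s /\ z = false /\ q' = 1 /\ k = 0) \/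
  (q = 1 /\ In a sig /\
     match cls a, z with
     | Up, false => q' = 1 /\ k = 1
     | Up, true => q' = 1 /\ k = 2
     | Down bad, true => q' = 1 /\ k = 0
     | Down bad, false => bad = true /\ q' = 2 /\ k = 0
     | Stay, false => q' = 1 /\ k = 0
     | Stay, true => q' = 1 /\ k = 1
     end).
Proof.
  cbn; intros [E|H]; [injection E as <- <- <- <- <-; auto 6|].
  apply in_flat_map in H as (o & Ho & E). right.
  destruct (cls o) as [|bad|] eqn:Eo; cbn in E; [| destruct bad; cbn in E |];
    repeat (destruct E as [E|E]); try easy;
    injection E as <- <- <- <- <-; rewrite Eo; auto 6.
Qed.

Lemma counter_doca_deterministic : deterministic D.
Proof.
  repeat split; try easy.
  - apply dtr_inv in H, H0; destruct (cls a) as [|[]|], z; intuition congruence.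
  - apply dtr_inv in H, H0; destruct (cls a) as [|[]|], z; intuition congruence.
Qed.

Lemma drun_sound u c c' : drun D u c c' -> fst c' = 2 ->
  (fst c = 1 -> acc cls (snd c) u /\ Forall (fun o => In o sig) u) /\
  (fst c = 2 -> u = []) /\
  (c = (0, 0) -> exists v, u = s :: v /\ acc cls 0 v).
Proof.
  induction 1 as [c|w c c1 c2 H1 H2 IH|a w c c1 c2 H1 H2 IH]; intros Hf.
  - split; [intros E; congruence|split; [auto|intros ->; discriminate]].
  - inversion H1; subst; easy.
  - destruct (IH Hf) as (IH1 & IH2 & _); clear IH.
    inversion H1 as [|q b n q' k Ht]; subst; cbn in *.
    destruct (dtr_inv _ _ _ _ _ Ht) as [(-> & -> & Hn & -> & ->)|(-> & Ha & E)].
    + split; [easy|split; [easy|]]. intros E; injection E as ->.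
      destruct (IH1 eq_refl) as [Hacc _]. eauto.
    + split; [intros _|split; easy].
      destruct (cls a) as [|bad|] eqn:Ea; destruct n as [|n]; cbn in *;
        repeat match goal with H : _ /\ _ |- _ => destruct H end; subst;
        unfold cupd in *; cbn in *;
        rewrite ?Nat.sub_0_r, ?Nat.add_0_r, ?(Nat.add_comm n) in *; cbn in *;
        try (destruct (IH1 eq_refl)); try rewrite (IH2 eq_refl); auto.
Qed.

Lemma drun_complete u : forall n, Forall (fun o => In o sig) u -> acc cls n u ->
  exists m, drun D u (1, n) (2, m).
Proof.
  induction u as [|o u IH]; cbn; intros n Hu Hacc; [destruct Hacc|].
  inversion Hu as [|? ? Ho Hu']; subst.
  assert (Hgo : forall q k, In (1, o, negb (n =? 0), q, k) (dtr D) ->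
      (exists m, drun D u (q, cupd n k) (2, m)) -> exists m, drun D (o :: u) (1, n) (2, m)).
  { intros q k Hin [m Hr]; exists m. eapply dr_let; [|exact Hr]. apply ds_let; auto. }
  assert (Hin : forall z q k, In (1, o, z, q, k) (match cls o with
      | Up => [(1, o, false, 1, 1); (1, o, true, 1, 2)]
      | Down bad => (1, o, true, 1, 0) :: (if bad then [(1, o, false, 2, 0)] else [])
      | Stay => [(1, o, false, 1, 0); (1, o, true, 1, 1)]
      end) -> In (1, o, z, q, k) (dtr D)).
  { intros z q k H; cbn; right; apply in_flat_map; exists o; auto. }
  destruct (cls o) as [|bad|] eqn:Eo.
  - destruct n as [|n].
    + apply (Hgo 1 1); [apply Hin; cbn; auto|]. apply IH; auto.
    + apply (Hgo 1 2); [apply Hin; cbn; auto|].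
      replace (cupd (S n) 2) with (S (S n)) by (unfold cupd; cbn; lia). apply IH; auto.
  - destruct n as [|n].
    + destruct Hacc as [-> ->].
      apply (Hgo 2 0); [apply Hin; cbn; auto|]. exists 0; apply dr_nil.
    + apply (Hgo 1 0); [apply Hin; cbn; auto|].
      replace (cupd (S n) 0) with n by (unfold cupd; cbn; lia). apply IH; auto.
  - destruct n as [|n].
    + apply (Hgo 1 0); [apply Hin; cbn; auto|]. apply IH; auto.
    + apply (Hgo 1 1); [apply Hin; cbn; auto|].
      replace (cupd (S n) 1) with (S n) by (unfold cupd; cbn; lia). apply IH; auto.
Qed.

Lemma counter_doca_spec u : dlang D u <-> counter_lang sig s cls u.
Proof.
  split.
  - intros [Hu (qf & n & [<-|[]] & Hr)]. split; auto.
    apply (drun_sound _ _ _ Hr eq_refl); reflexivity.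
  - intros [Hu (v & -> & Hacc)]. split; auto.
    inversion Hu as [|? ? _ Hv]; subst.
    destruct (drun_complete v 0 Hv Hacc) as [m Hr].
    exists 2, m; split; [cbn; auto|].
    eapply dr_let; [|exact Hr]. apply (ds_let D 0 s 0 1 0); cbn; auto.
Qed.

(** The kind of an operation is determined by [cls], so each word of the counter language has a
    canonical tagging, and all letter identifications can be the identity. *)
Lemma counter_vpa_is_doca_vpe : is_doca_vpe (vlang A).
Proof.
  exists D, (fun o => o), (fun o => o), (fun o => o), xl.
  split; [apply counter_doca_deterministic|].
  do 3 (split; [now intros a b _ _|]).
  split; [reflexivity|]. split.
  { intros a Ha E; injection E as <-; auto. }
  cbv zeta. set (iota := fun p : nat * rkind =>
      match snd p with
      | Call => LRole (Call, fst p)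
      | Int => LRole (Int, fst p)
      | Ret => LRole (Ret, fst p)
      end).
  set (tag := map (fun o => (o, kind_of cls o))).
  assert (Htag : forall u, map iota (tag u) = map ol u).
  { intros u; unfold tag; rewrite map_map; apply map_ext; intros o.
    unfold iota, letter_of; cbn; destruct (kind_of cls o); reflexivity. }
  assert (Hfst : forall u, map fst (tag u) = u).
  { intros u; unfold tag; rewrite map_map; apply map_id. }
  assert (Hin : forall u, Forall (fun o => In o sig) u ->
      Forall (fun p : nat * rkind => In (fst p) sig) (tag u)).
  { intros u Hu; unfold tag; apply Forall_map; exact Hu. }
  split.
  - intros w Hw. apply counter_vpa_spec in Hw as (u & [Hu Hv] & ->).
    exists (tag u); rewrite Htag; split; auto; exact (Hin u Hu).
  - intros u; rewrite counter_doca_spec; split.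
    + intros Hu. exists (tag u). split; [exact (Hin u (proj1 Hu))|].
      rewrite Htag; split; [|apply Hfst]. apply counter_vpa_spec; eauto.
    + intros (ws & _ & Hw & <-). apply counter_vpa_spec in Hw as (u & Hu & E).
      apply interleave_inj in E.
      replace (map fst ws) with u; auto.
      clear -E. revert u E; induction ws as [|[o k] ws IH]; intros [|b u] E;
        cbn in *; try discriminate; auto.
      injection E as E1 E2. f_equal; auto.
      unfold iota, letter_of in E1; cbn in E1; destruct k; congruence.
Qed.

End Counter.

(** * Multi-stack programs as concepts *)

Inductive code : Type :=
| Goto : nat -> code
| Push : nat -> nat -> code -> code
| Pop : nat -> (nat -> code) -> code
| Stop : bool -> code.

Definition upd (st : nat -> list nat) (i : nat) (l : list nat) : nat -> list nat :=
  fun j => if j =? i then l else st j.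

(** The successor keeps 0 free for [next_role]. *)
Definition opcode (push : bool) (i a : nat) : nat :=
  S (to_nat (if push then 1 else 0, to_nat (i, a))).

(* From the point of view of stack [i] holding [a] on top, popping any symbol of [i] other than [a] is the forbidden final letter. *)
Definition mismatch (i a : nat) (c : nat) : action :=
  match c with
  | 0 => Stay
  | S m => let (p, r) := of_nat m in let (j, b) := of_nat r in
      if j =? i then (if p =? 1 then Up else Down (negb (b =? a))) else Stay
  end.

Lemma mismatch_opcode i a p j b :
  mismatch i a (opcode p j b) =
  if j =? i then (if p then Up else Down (negb (b =? a))) else Stay.
Proof.
  unfold mismatch, opcode. rewrite !cancel_of_to. now destruct p.
Qed.

Lemma opcode_inj p i a q j b : opcode p i a = opcode q j b -> p = q /\ i = j /\ a = b.
Proof.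
  unfold opcode; intros H. apply eq_add_S, to_nat_inj in H.
  assert (Hp : (if p then 1 else 0) = (if q then 1 else 0)) by congruence.
  assert (Hia : to_nat (i, a) = to_nat (j, b)) by congruence.
  apply to_nat_inj in Hia. injection Hia as -> ->.
  destruct p, q; auto; discriminate.
Qed.

Definition next_role : role := (Int, 0).

Definition all_next (C : concept) : concept := CNeg (CEx next_role (CNeg C)).

(* The three role kinds of an operation are asserted together, so that each language can read it with the kind that suits it. *)
Definition does (p : bool) (i a : nat) : concept :=
  CAnd (CSelf (Call, opcode p i a))
    (CAnd (CSelf (Int, opcode p i a)) (CSelf (Ret, opcode p i a))).

Fixpoint conjunction (l : list concept) : concept :=
  match l with [] => CTop | C :: l => CAnd C (conjunction l) end.

Lemma sem_conjunction I l d : sem I (conjunction l) d <-> forall C, In C l -> sem I C d.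
Proof.
  induction l as [|C l IH]; cbn; [easy|]. rewrite IH; split.
  - intros [H1 H2] E [<-|H]; auto.
  - auto.
Qed.

Lemma langs_conjunction A l : In A (langs (conjunction l)) -> exists C, In C l /\ In A (langs C).
Proof.
  induction l as [|C l IH]; cbn; [easy|]. rewrite in_app_iff; intros [H|H]; [eauto|].
  destruct (IH H) as (E & HE & HA); eauto.
Qed.

Definition next_star : vpa := {|
  valph := [LRole next_role]; vinit := [0]; vfinal := [0];
  vcall := []; vint := [(0, LRole next_role, 0)]; vret := [] |}.

Lemma next_star_spec w : vlang next_star w <-> Forall (fun a => a = LRole next_role) w.
Proof.
  split.
  - intros [H _]. eapply Forall_impl; [|exact H]. intros a [->|[]]; auto.
  - intros H; split.
    + eapply Forall_impl; [|exact H]. intros a ->; cbn; auto.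
    + exists 0, 0, []; cbn; repeat split; auto.
      induction H as [|a w -> H IH]; [constructor|].
      eapply vr_cons; [|exact IH]. apply vs_int; cbn; auto.
Qed.

Lemma next_star_regular : is_regular (vlang next_star).
Proof.
  exists {| ninit := [0]; nfinal := [0]; ntrans := [(0, LRole next_role, 0)] |}.
  intros w; rewrite next_star_spec; split.
  - intros H. exists 0, 0; cbn; repeat split; auto.
    induction H as [|a w -> H IH]; [constructor|].
    eapply nr_cons; [|exact IH]; cbn; auto.
  - intros (q0 & qf & _ & _ & H).
    induction H as [|a w q q' q'' [E|[]] H IH]; constructor; auto; congruence.
Qed.

Section Program.
Variables (prog : nat -> code) (nstates nstacks nsyms : nat).

Definition operations : list nat :=
  flat_map (fun i => flat_map (fun a => [opcode true i a; opcode false i a]) (seq 0 nsyms))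
    (seq 0 nstacks).

(** The number 0 makes the separator letter equal to [next_role]: a word alternates between a
    self-loop at a time point and a move to the next one. *)
Definition mismatch_vpa (i a : nat) : vpa :=
  counter_vpa operations 0 (opcode true i a) (mismatch i a).

(** [Goto] becomes a mere name, unfolded by [program_rules], so looping programs have finite
    concepts. A pop is a disjunction over all symbols, from which the mismatch rules select the
    right one. *)
Fixpoint code_concept (c : code) : concept :=
  match c with
  | Goto q => CName q
  | Push i a c => CAnd (does true i a) (CAnd (CEx next_role CTop) (all_next (code_concept c)))
  | Pop i f => CAnd (CEx next_role CTop)
      (CNeg (conjunction (map
        (fun b => CNeg (CAnd (does false i b) (all_next (code_concept (f b))))) (seq 0 nsyms))))
  | Stop true => CNeg CTop
  | Stop false => CTop
  end.

Definition program_rules : concept :=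
  conjunction (map (fun q => CNeg (CAnd (CName q) (CNeg (code_concept (prog q))))) (seq 0 nstates)
     ++ map (fun p => CNeg (CExL (mismatch_vpa (fst p) (snd p)) CTop))
          (list_prod (seq 0 nstacks) (seq 0 nsyms))).

Definition invariant_rules : concept := CNeg (CExL next_star (CNeg program_rules)).

Definition run_concept (c : code) : concept := CAnd invariant_rules (code_concept c).

Inductive halts (b : bool) : code -> (nat -> list nat) -> Prop :=
| halts_stop st : halts b (Stop b) st
| halts_goto q st : q < nstates -> halts b (prog q) st -> halts b (Goto q) st
| halts_push i a c st : i < nstacks -> a < nsyms ->
    halts b c (upd st i (a :: st i)) -> halts b (Push i a c) st
| halts_pop i a r f st : i < nstacks -> a < nsyms -> st i = a :: r ->
    halts b (f a) (upd st i r) -> halts b (Pop i f) st.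

Lemma in_operations p i a : i < nstacks -> a < nsyms -> In (opcode p i a) operations.
Proof.
  intros Hi Ha. apply in_flat_map; exists i; split; [apply in_seq; lia|].
  apply in_flat_map; exists a; split; [apply in_seq; lia|]. destruct p; cbn; auto.
Qed.

Lemma zero_notin_operations : ~ In 0 operations.
Proof.
  intros H; apply in_flat_map in H as (i & _ & H).
  apply in_flat_map in H as (a & _ & [H|[H|[]]]); discriminate.
Qed.

Lemma mismatch_vpa_spec i a w : i < nstacks -> a < nsyms ->
  vlang (mismatch_vpa i a) w <->
  exists u, counter_lang operations (opcode true i a) (mismatch i a) u /\
    w = interleave (LRole next_role) (map (letter_of (mismatch i a)) u).
Proof.
  intros Hi Ha; apply counter_vpa_spec.
  - apply in_operations; auto.
  - now rewrite mismatch_opcode, Nat.eqb_refl.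
Qed.

Lemma code_concept_langs c A : ~ In A (langs (code_concept c)).
Proof.
  induction c as [q|i a c IH|i f IH|[]]; cbn; auto.
  intros H; apply langs_conjunction in H as (C & HC & HA).
  apply in_map_iff in HC as (b & <- & _); cbn in HA. exact (IH b HA).
Qed.

Lemma run_concept_in_fragment c : in_fragment (run_concept c).
Proof.
  intros A H. cbn [run_concept invariant_rules langs] in H.
  apply in_app_or in H as [[<-|H]|H].
  - left; apply next_star_regular.
  - apply langs_conjunction in H as (C & HC & HA).
    apply in_app_or in HC as [HC|HC]; apply in_map_iff in HC as (q & <- & Hq).
    + now apply code_concept_langs in HA.
    + destruct q as [i a]; destruct HA as [<-|[]]. right.
      apply in_prod_iff in Hq as [Hi Ha]; apply in_seq in Hi, Ha.
      cbn [fst snd]. apply counter_vpa_is_doca_vpe.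
      * exact zero_notin_operations.
      * apply in_operations; lia.
      * now rewrite mismatch_opcode, Nat.eqb_refl.
  - now apply code_concept_langs in H.
Qed.

(** * Unsatisfiability for runs that return true *)

Section Unsatisfiable.
Variable (I : interp).

Definition loops (o : nat) (d : dom I) : Prop := forall k, rint I (k, o) d d.

Lemma sem_does p i a d : sem I (does p i a) d <-> loops (opcode p i a) d.
Proof.
  cbn; split.
  - intros (H1 & H2 & H3) []; auto.
  - intros H; repeat split; apply H.
Qed.

Fixpoint segment (d : dom I) (u : list nat) (e : dom I) : Prop :=
  match u with
  | [] => d = e
  | o :: u => In o operations /\ loops o d /\
      exists d', rint I next_role d d' /\ segment d' u e
  end.

Lemma segment_app u v d e f : segment d u e -> segment e v f -> segment d (u ++ v) f.
Proof.
  revert d; induction u as [|o u IH]; cbn; intros d; [now intros ->|].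
  intros (Ho & Hl & d' & Hx & Hs) Hv; repeat split; eauto.
Qed.

(** Operations are self-loops in all three role kinds, so the same time points can be read with the
    letter kinds belonging to any stack [i]. *)
Lemma segment_path i a o u d e : segment d (o :: u) e ->
  forall o', loops o' e -> lpath I
    (letter_of (mismatch i a) o ::
       flat_map (fun b => [LRole next_role; b]) (map (letter_of (mismatch i a)) (u ++ [o']))) d e.
Proof.
  intros (_ & Hl & d' & Hx & Hs) o' Ho'.
  apply lp_cons with d; [apply Hl|].
  clear o Hl. revert d d' Hx Hs; induction u as [|o2 u IH]; cbn; intros d d' Hx Hs.
  - subst d'. apply lp_cons with e; [exact Hx|].
    apply lp_cons with e; [apply Ho'|constructor].
  - destruct Hs as (_ & Hl2 & d2 & Hx2 & Hs).
    apply lp_cons with d'; [exact Hx|]. apply lp_cons with d'; [apply Hl2|]. eauto.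
Qed.

Lemma segment_operations u d e : segment d u e -> Forall (fun o => In o operations) u.
Proof.
  revert d; induction u as [|o u IH]; cbn; intros d; [constructor|].
  intros (Ho & _ & d' & _ & Hs); constructor; eauto.
Qed.

(** Balance is defined by its effect on [acc] rather than by a grammar; closure under concatenation
    is then composition of implications. *)
Definition balanced (i : nat) (w : list nat) : Prop :=
  forall a n v, acc (mismatch i a) n v -> acc (mismatch i a) n (w ++ v).

Lemma balanced_app i u v : balanced i u -> balanced i v -> balanced i (u ++ v).
Proof. intros Hu Hv a n w Hw; rewrite <- app_assoc; apply Hu, Hv, Hw. Qed.

(** Inside the bracket the counter is one higher, so the closing pop meets a positive counter and
    cannot be a mismatch, whatever [b] is. *)
Lemma balanced_bracket i u a b : balanced i u ->
  balanced i (opcode true i a :: u ++ [opcode false i b]).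
Proof.
  intros Hu c n v Hv. cbn [List.app acc].
  rewrite mismatch_opcode, Nat.eqb_refl, <- app_assoc. apply Hu.
  cbn [List.app acc]. now rewrite mismatch_opcode, Nat.eqb_refl.
Qed.

Lemma balanced_other i j p a : j <> i -> balanced i [opcode p j a].
Proof.
  intros Hj c n v Hv. cbn [List.app acc]. rewrite mismatch_opcode.
  now rewrite (proj2 (Nat.eqb_neq j i) Hj).
Qed.

Definition reaches (d e : dom I) : Prop :=
  exists w, Forall (fun a => a = LRole next_role) w /\ lpath I w d e.

Lemma reaches_next d e f : reaches d e -> rint I next_role e f -> reaches d f.
Proof.
  intros (w & Hw & Hp) Hx. exists (w ++ [LRole next_role]). split.
  - apply Forall_app; auto.
  - clear Hw. induction Hp as [d|a w d d' e Hs Hp IH]; cbn.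
    + eapply lp_cons; [exact Hx|constructor].
    + eapply lp_cons; eauto.
Qed.

Variable root : dom I.
Hypothesis Hroot : sem I invariant_rules root.

(* A stack content holds at [d] when each symbol is the label of the last unmatched push on the way to [d]. *)
Fixpoint holds (i : nat) (st : list nat) (d : dom I) : Prop :=
  match st with
  | [] => True
  | a :: r => a < nsyms /\ exists e w, reaches root e /\ holds i r e /\ balanced i w /\
      segment e (opcode true i a :: w) d
  end.

Lemma holds_extend i st d w e : holds i st d -> balanced i w -> segment d w e -> holds i st e.
Proof.
  destruct st as [|a r]; cbn [holds]; auto.
  intros (Ha & p & u & Hp & Hr & Hu & Hs) Hw Hd. split; auto.
  exists p, (u ++ w); repeat split; auto using balanced_app.
  - apply Hs.
  - apply Hs.
  - eapply (segment_app (opcode true i a :: u)); eauto.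
Qed.

(** [invariant_rules] yields the rules at a reachable point only up to double negation, hence the
    conclusions are refutations of the concepts that the rules negate. *)
Lemma reaches_rules d C : reaches root d -> sem I C d ->
  (forall q, C = CAnd (CName q) (CNeg (code_concept (prog q))) -> ~ q < nstates) /\
  (forall i a, C = CExL (mismatch_vpa i a) CTop -> i < nstacks -> ~ a < nsyms).
Proof.
  intros (w & Hw & Hp) HC.
  assert (Hn : ~ In (CNeg C) (map (fun q => CNeg (CAnd (CName q) (CNeg (code_concept (prog q)))))
                                (seq 0 nstates)
     ++ map (fun p => CNeg (CExL (mismatch_vpa (fst p) (snd p)) CTop))
          (list_prod (seq 0 nstacks) (seq 0 nsyms)))).
  { intros Hin. apply Hroot. exists d, w; repeat split; auto; try (now apply next_star_spec).
    cbn; intros Hrules. unfold program_rules in Hrules. rewrite sem_conjunction in Hrules.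
    exact (Hrules _ Hin HC). }
  split.
  - intros q -> Hq. apply Hn, in_or_app; left.
    apply in_map_iff; exists q; split; auto. apply in_seq; lia.
  - intros i a -> Hi Ha. apply Hn, in_or_app; right.
    apply in_map_iff; exists (i, a); split; auto. apply in_prod; apply in_seq; lia.
Qed.

(** Otherwise the way from the push of [a] to this pop would spell a forbidden word. *)
Lemma pop_matches i a r b d : i < nstacks -> b < nsyms ->
  holds i (a :: r) d -> loops (opcode false i b) d -> a = b.
Proof.
  intros Hi Hb (Ha & p & w & Hp & _ & Hw & Hs) Hl.
  destruct (Nat.eq_dec a b) as [|Hab]; auto; exfalso.
  refine (proj2 (reaches_rules p (CExL (mismatch_vpa i a) CTop) Hp _) i a eq_refl Hi Ha).
  exists d. eexists; split; [|split; [exact (segment_path i a _ _ _ _ Hs _ Hl)|exact Logic.I]].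
  apply mismatch_vpa_spec; auto.
  exists (opcode true i a :: w ++ [opcode false i b]); split; [|reflexivity]. split.
  - rewrite app_comm_cons. apply Forall_app; split; [eapply segment_operations; eauto|].
    constructor; auto using in_operations.
  - eexists; split; [reflexivity|]. apply Hw. cbn [acc].
    rewrite mismatch_opcode, Nat.eqb_refl.
    assert (b =? a = false) as -> by (apply Nat.eqb_neq; auto). auto.
Qed.

Lemma holds_step p i a d e st : i < nstacks -> a < nsyms ->
  loops (opcode p i a) d -> rint I next_role d e ->
  (forall j, holds j (st j) d) -> forall j, j <> i -> holds j (st j) e.
Proof.
  intros Hi Ha Hl Hx H j Hj.
  eapply holds_extend with (w := [opcode p i a]); [apply H|apply balanced_other; auto|].
  cbn; repeat split; auto using in_operations. eauto.
Qed.

(** The model is forced to follow the run up to [Stop true], whose concept is empty. Since the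
    conclusion is a refutation, a pop is treated by refuting every disjunct. *)
Lemma halts_true_contradiction b c st : halts b c st -> b = true ->
  forall d, reaches root d -> (forall i, holds i (st i) d) -> ~ sem I (code_concept c) d.
Proof.
  induction 1 as [st|q st Hq Hh IH|i a c st Hi Ha Hh IH|i a r f st Hi Ha Hst Hh IH];
    intros -> d Hd Hs Hc.
  - apply Hc; exact Logic.I.
  - refine (proj1 (reaches_rules d (CAnd _ _) Hd _) q eq_refl Hq).
    split; [exact Hc|]. exact (IH eq_refl d Hd Hs).
  - destruct Hc as (Hl & (e & Hx & _) & Hc). apply sem_does in Hl.
    apply Hc. exists e; split; auto. apply IH; auto.
    + eapply reaches_next; eauto.
    + intros j; unfold upd. destruct (Nat.eqb_spec j i) as [->|Hj].
      (* The new top symbol is pushed at [d] itself, followed by the empty balanced word. *)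
      * split; auto. exists d, []; split; [auto|split; [apply Hs|split; [now intros ? ? ?|]]].
        cbn; repeat split; auto using in_operations; eauto.
      * eapply holds_step with (p := true); eauto.
  - destruct Hc as ((e & Hx & _) & Hc). apply Hc. rewrite sem_conjunction.
    intros C HC; apply in_map_iff in HC as (b & <- & Hb); apply in_seq in Hb.
    intros [Hl Hn]; apply sem_does in Hl.
    pose proof (Hs i) as Hi'; rewrite Hst in Hi'.
    assert (a = b) as <- by (eapply pop_matches; eauto; lia).
    apply Hn. exists e; split; auto. apply IH; auto.
    + eapply reaches_next; eauto.
    + intros j; unfold upd. destruct (Nat.eqb_spec j i) as [->|Hj].
      (* The remaining stack held at the point [p] of the push; from there to [e] the operations
         form a balanced bracket. *)
      * destruct Hi' as (_ & p & w & Hp & Hr & Hw & Hseg).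
        eapply holds_extend; [exact Hr|apply (balanced_bracket i w a a Hw)|].
        rewrite app_comm_cons. eapply segment_app; [exact Hseg|].
        cbn; repeat split; auto using in_operations; eauto.
      * eapply holds_step with (p := false); eauto.
Qed.

End Unsatisfiable.

Lemma halts_true_unsat c : halts true c (fun _ => []) -> ~ satisfiable (run_concept c).
Proof.
  intros H (I & d & Hr & Hc).
  eapply (halts_true_contradiction I d Hr true c _ H eq_refl d); auto.
  - exists []; split; constructor.
  - intros i; exact Logic.I.
Qed.

(** * The trace model of a run that returns false *)

(* Domain elements are remaining traces: for each time point the state names it carries and the operation it performs. *)
Definition trace : Type := list (list nat * option (bool * nat * nat)).

Definition traces : interp := {|
  dom := trace;
  dom_elt := [];
  cint := fun q l => match l with (ns, _) :: _ => In q ns | [] => False end;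
  rint := fun r l l' =>
    match snd r with
    | 0 => fst r = Int /\ exists ns o, l = (ns, Some o) :: l'
    | S _ => l = l' /\ exists ns p i a t, l = (ns, Some (p, i, a)) :: t /\ snd r = opcode p i a
    end |}.

Fixpoint valid (st : nat -> list nat) (l : trace) : Prop :=
  match l with
  | (_, Some (true, i, a)) :: t => valid (upd st i (a :: st i)) t
  | (_, Some (false, i, a)) :: t => exists r, st i = a :: r /\ valid (upd st i r) t
  | _ => True
  end.

Fixpoint names_ok (l : trace) : Prop :=
  match l with
  | [] => True
  | (ns, _) :: t => (forall q, In q ns -> sem traces (code_concept (prog q)) l) /\ names_ok t
  end.

Lemma traces_next l l' : rint traces next_role l l' <-> exists ns o, l = (ns, Some o) :: l'.
Proof. cbn; intuition. Qed.

Lemma traces_does p i a ns t : sem traces (does p i a) ((ns, Some (p, i, a)) :: t).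
Proof. cbn; repeat split; eauto 10. Qed.

Lemma traces_all_next C ns o t : sem traces C t -> sem traces (all_next C) ((ns, o) :: t).
Proof.
  intros HC (l & Hl & Hn). apply traces_next in Hl as (ns' & o' & E).
  injection E as -> -> <-. exact (Hn HC).
Qed.

(** One time point may carry several names, because [Goto] takes no time. Adding a name changes the
    domain element, but names of the current point occur only positively and all else depends on [o]
    and [t]. *)
Lemma code_concept_more_names c ns o t q : sem traces (code_concept c) ((ns, o) :: t) ->
  sem traces (code_concept c) ((q :: ns, o) :: t).
Proof.
  assert (Hdoes : forall p i a, sem traces (does p i a) ((ns, o) :: t) ->
      sem traces (does p i a) ((q :: ns, o) :: t)).
  { intros p i a H. apply sem_does; intros k. apply sem_does in H. specialize (H k).
    cbn in *. destruct H as (_ & ns' & p' & i' & a' & t' & E & Ho).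
    injection E as <- -> <-. eauto 10. }
  assert (Hall : forall C, sem traces (all_next C) ((ns, o) :: t) ->
      sem traces (all_next C) ((q :: ns, o) :: t)).
  { intros C H (l & Hl & Hn). apply traces_next in Hl as (ns' & o' & E).
    injection E as <- -> ->. apply H. exists l; split; auto. apply traces_next; eauto. }
  assert (Hex : sem traces (CEx next_role CTop) ((ns, o) :: t) ->
      sem traces (CEx next_role CTop) ((q :: ns, o) :: t)).
  { intros (l & Hl & _). apply traces_next in Hl as (ns' & o' & E).
    injection E as <- -> ->. exists l; split; [|exact Logic.I]. apply traces_next; eauto. }
  destruct c as [q'|i a c|i f|[]]; cbn [code_concept].
  - cbn; auto.
  - intros (H1 & H2 & H3); split; [|split]; auto.
  - intros (H1 & H2); split; auto. intros H; apply H2.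
    rewrite sem_conjunction in *. intros C HC.
    specialize (H C HC). apply in_map_iff in HC as (b & <- & _).
    intros [Hb1 Hb2]; apply H; exact (conj (Hdoes _ _ _ Hb1) (Hall _ Hb2)).
  - auto.
  - auto.
Qed.

(** The trace grows backwards from the end of the run: [Goto] adds a name to its head, a push or pop
    prepends a time point. *)
Lemma halts_trace b c st : halts b c st -> b = false ->
  exists ns o t, sem traces (code_concept c) ((ns, o) :: t) /\
    names_ok ((ns, o) :: t) /\ valid st ((ns, o) :: t).
Proof.
  induction 1 as [st|q st Hq Hh IH|i a c st Hi Ha Hh IH|i a r f st Hi Ha Hst Hh IH];
    intros ->; try destruct (IH eq_refl) as (ns & o & t & H1 & H2 & H3).
  - exists [], None, []; cbn; repeat split; easy.
  - exists (q :: ns), o, t. split; [cbn; auto|]. split; [|exact H3].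
    destruct H2 as [H2 H2']; split; auto.
    intros q' [<-|Hq']; apply code_concept_more_names; auto.
  - exists [], (Some (true, i, a)), ((ns, o) :: t). split; [|split; [split; auto; easy|exact H3]].
    split; [apply traces_does|split; [|apply traces_all_next; auto]].
    exists ((ns, o) :: t); split; [|exact Logic.I]. apply traces_next; eauto.
  - exists [], (Some (false, i, a)), ((ns, o) :: t).
    split; [|split; [split; auto; easy|exists r; auto]].
    split; [exists ((ns, o) :: t); split; [|exact Logic.I]; apply traces_next; eauto|].
    cbn [sem]. rewrite sem_conjunction; intros H.
    refine (H _ (in_map _ _ a _) _); [apply in_seq; lia|].
    split; [apply traces_does|apply traces_all_next; auto].
Qed.

(** The distinguished [a] stays below exactly [n] symbols of stack [i], so a pop of this stack at
    counter 0 removes [a] itself and is no mismatch. The contents [st] are those after the operation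
    of [p]. *)
Lemma valid_no_mismatch i a u : forall n st xs ys p l e, ~ In 0 u ->
  acc (mismatch i a) n u -> valid st l -> st i = xs ++ a :: ys -> length xs = n ->
  ~ lpath traces (flat_map (fun b => [LRole next_role; b])
      (map (letter_of (mismatch i a)) u)) (p :: l) e.
Proof.
  induction u as [|o u IH]; intros n st xs ys p l e H0 Hacc Hv Hst Hn H; [exact Hacc|].
  apply not_in_cons in H0 as [Ho0 H0]. cbn in H. inversion H as [|? ? ? d1 ? Hx H1]; subst; clear H.
  apply traces_next in Hx as (ns & o1 & E). injection E as -> <-.
  inversion H1 as [|? ? ? d2 ? Ho H2]; subst; clear H1.
  cbn in Ho. destruct o as [|o]; [congruence|].
  destruct Ho as (<- & ns' & q & j & b & t & -> & Ho).
  rewrite Ho in Hacc. cbn [acc] in Hacc. rewrite mismatch_opcode in Hacc.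
  destruct (Nat.eqb_spec j i) as [->|Hj]; destruct q.
  - refine (IH _ _ (b :: xs) ys _ t _ H0 Hacc Hv _ eq_refl H2).
    unfold upd; rewrite Nat.eqb_refl, Hst; reflexivity.
  - destruct Hv as (r & Hr & Hv). rewrite Hst in Hr.
    destruct xs as [|x xs]; cbn in Hacc, Hr.
    + destruct Hacc as [Hb _]. injection Hr as -> _. now rewrite Nat.eqb_refl in Hb.
    + injection Hr as -> <-.
      refine (IH _ _ xs ys _ t _ H0 Hacc Hv _ eq_refl H2).
      unfold upd; rewrite Nat.eqb_refl; reflexivity.
  - refine (IH _ _ xs ys _ t _ H0 Hacc Hv _ eq_refl H2).
    unfold upd. destruct (Nat.eqb_spec i j); [congruence|auto].
  - destruct Hv as (r & Hr & Hv).
    refine (IH _ _ xs ys _ t _ H0 Hacc Hv _ eq_refl H2).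
    unfold upd. destruct (Nat.eqb_spec i j); [congruence|auto].
Qed.

Lemma valid_rules st l : valid st l -> names_ok l -> sem traces program_rules l.
Proof.
  intros Hv Hn. unfold program_rules; rewrite sem_conjunction; intros C HC.
  apply in_app_or in HC as [HC|HC]; apply in_map_iff in HC as (q & <- & Hq).
  - intros [Hq1 Hq2]; apply Hq2. destruct l as [|[ns o] t]; [destruct Hq1|].
    apply Hn; exact Hq1.
  - destruct q as [i a]; cbn [fst snd]. intros (e & w & Hw & Hp & _).
    apply in_prod_iff in Hq as [Hi Ha]; apply in_seq in Hi, Ha.
    apply mismatch_vpa_spec in Hw as (u & [Hu (v & -> & Hacc)] & ->); try lia.
    assert (H0 : ~ In 0 v).
    { intros H0. rewrite Forall_forall in Hu. apply zero_notin_operations, Hu; right; auto. }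
    cbn in Hp. inversion Hp as [|? ? ? d1 ? Ho Hp']; subst; clear Hp.
    cbn in Ho. destruct Ho as (<- & ns & p & j & b & t & -> & Ho).
    apply opcode_inj in Ho as (<- & <- & <-).
    refine (valid_no_mismatch i a v 0 _ [] (st i) _ t _ H0 Hacc Hv _ eq_refl Hp').
    unfold upd; now rewrite Nat.eqb_refl.
Qed.

Lemma halts_false_sat c : halts false c (fun _ => []) -> satisfiable (run_concept c).
Proof.
  intros H. destruct (halts_trace _ _ _ H eq_refl) as (ns & o & t & H1 & H2 & H3).
  exists traces, ((ns, o) :: t); split; auto.
  intros (e & w & Hw & Hp & Hn). apply Hn; clear Hn. apply next_star_spec in Hw.
  (* Validity travels along [next_role] while each operation updates the stacks, hence the
     existential. *)
  assert (Hinv : exists st, valid st e /\ names_ok e).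
  { clear H1. revert H2 H3; generalize (fun _ : nat => @nil nat) as st.
    induction Hp as [d|a w d d' e Hs Hp IH]; intros st H2 H3; eauto.
    inversion Hw as [|? ? -> Hw']; subst.
    apply traces_next in Hs as (ns' & [[p i] b] & ->).
    destruct H2 as [_ H2]. destruct p; [|destruct H3 as (r & _ & H3)]; eauto. }
  destruct Hinv as (st & Hv & Hok). exact (valid_rules st e Hv Hok).
Qed.

End Program.

(** * A six-stack evaluator *)

Inductive eval : term -> term -> Prop :=
| eval_lam s : eval (lam s) (lam s)
| eval_app s t b v r : eval s (lam b) -> eval t (lam v) -> eval (subst b 0 (lam v)) r ->
    eval (app s t) r.

Lemma step_eval s s' : step s s' -> forall r, eval s' r -> eval s r.
Proof.
  induction 1 as [s t|s s' t H IH|s t t' H IH]; intros r Hr.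
  - eapply eval_app; [apply eval_lam|apply eval_lam|exact Hr].
  - inversion Hr; subst; eapply eval_app; eauto.
  - inversion Hr; subst; eapply eval_app; eauto.
Qed.

Lemma star_eval s b : star s (lam b) -> eval s (lam b).
Proof.
  remember (lam b) as r eqn:E; induction 1 as [s|s s' t Hs H IH]; subst.
  - apply eval_lam.
  - eapply step_eval; eauto.
Qed.

Notation tA := 0 (only parsing).
Notation tL := 1 (only parsing).
Notation tE := 2 (only parsing).
Notation tZ := 3 (only parsing).
Notation tS := 4 (only parsing).
Notation bot := 5 (only parsing).
Notation over := 6 (only parsing).

(** Application is postfix, so [tA] finds both values on stack 1. Abstractions are bracketed on both
    sides, so their extent is visible in either reading direction. *)
Fixpoint tokens (s : term) : list nat :=
  match s with
  | var n => tZ :: repeat tS n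
  | app s t => tokens s ++ tokens t ++ [tA]
  | lam s => tL :: tokens s ++ [tE]
  end.

(* Stacks: 0 is the code still to be evaluated, 1 the reversed values separated by [bot], 2 and 3 hold the argument of the current substitution while it is copied, 4 is the binder depth in unary, 5 the part of 4 that has been compared with the current variable. *)
Definition evaluator (q : nat) : code :=
  match q with
  | 0 => Pop 0 (fun x => match x with
      | tA => Goto 2
      | tL => Push 1 bot (Push 1 tL (Goto 1))
      | bot => Pop 1 (fun _ => Pop 1 (fun _ => Pop 1 (fun y => Stop (y =? tS))))
      | _ => Stop false
      end)
  (* quote an abstraction up to its closing bracket *)
  | 1 => Pop 0 (fun x => match x with
      | tL => Push 1 tL (Push 4 tS (Goto 1))
      | tE => Push 1 tE (Pop 4 (fun y =>
                if y =? bot then Push 4 bot (Goto 0) else Goto 1))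
      | x => Push 1 x (Goto 1)
      end)
  (* fetch the argument *)
  | 2 => Pop 1 (fun x => if x =? bot then Pop 1 (fun _ => Goto 3) else Push 2 x (Goto 2))
  (* substitute, reading the body of the function backwards *)
  | 3 => Pop 1 (fun x => match x with
      | tA => Push 0 tA (Goto 3)
      | tL => Pop 4 (fun y =>
                if y =? bot then Push 4 bot (Pop 1 (fun _ => Goto 8)) else Push 0 tL (Goto 3))
      | tE => Push 0 tE (Push 4 tS (Goto 3))
      | tS => Push 0 tS (Pop 4 (fun y =>
                if y =? bot then Push 4 bot (Push 5 over (Goto 3)) else Push 5 tS (Goto 3)))
      | _ => Pop 4 (fun y =>
                if y =? bot then Push 4 bot (Pop 5 (fun z =>
                  if z =? over then Push 5 over (Goto 4) else Push 5 z (Goto 5)))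
                else Push 4 tS (Goto 4))
      end)
  (* another variable: restore the depth *)
  | 4 => Pop 5 (fun x => match x with
      | tS => Push 4 tS (Goto 4)
      | over => Goto 4
      | _ => Push 5 bot (Push 0 tZ (Goto 3))
      end)
  (* the substituted variable: restore the depth and discard the copied index *)
  | 5 => Pop 5 (fun x =>
      if x =? bot then Push 5 bot (Goto 6) else Push 4 tS (Pop 0 (fun _ => Goto 5)))
  | 6 => Pop 2 (fun x => if x =? bot then Push 2 bot (Goto 7) else Push 3 x (Goto 6))
  | 7 => Pop 3 (fun x =>
      if x =? bot then Push 3 bot (Goto 3) else Push 0 x (Push 2 x (Goto 7)))
  | 8 => Pop 2 (fun x => if x =? bot then Push 2 bot (Goto 0) else Goto 8)
  (* initially, transfer the loaded word to stack 0 *)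
  | _ => Pop 1 (fun x => if x =? bot then Push 1 bot (Goto 0) else Push 0 x (Goto 9))
  end.

Definition stacks (c w u u2 d d2 : list nat) (i : nat) : list nat :=
  match i with 0 => c | 1 => w | 2 => u | 3 => u2 | 4 => d | 5 => d2 | _ => [] end.

Lemma upd_stacks c w u u2 d d2 i l : i < 6 -> upd (stacks c w u u2 d d2) i l =
  match i with
  | 0 => stacks l w u u2 d d2
  | 1 => stacks c l u u2 d d2
  | 2 => stacks c w l u2 d d2
  | 3 => stacks c w u l d d2
  | 4 => stacks c w u u2 l d2
  | _ => stacks c w u u2 d l
  end.
Proof.
  intros Hi; apply functional_extensionality; intros j; unfold upd.
  do 6 (destruct i as [|i]; [do 6 (destruct j as [|j]; [reflexivity|]); reflexivity|]); lia.
Qed.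

Ltac micro :=
  repeat first
    [ eapply halts_push; [lia|lia|rewrite upd_stacks by lia; cbn [stacks]]
    | eapply halts_pop; [lia| |reflexivity|rewrite upd_stacks by lia]; [lia|cbn [Nat.eqb]] ].

Ltac macro := apply halts_goto; [lia|cbn [evaluator]; micro].

Section Evaluator.
Variable b : bool.

Local Notation runs := (halts evaluator 10 6 7 b).

Lemma tokens_bound s : Forall (fun x => x < bot) (tokens s).
Proof.
  induction s as [n|s IHs t IHt|s IH]; cbn.
  - constructor; [lia|]. apply Forall_forall; intros x Hx.
    apply repeat_spec in Hx; lia.
  - rewrite !Forall_app; repeat split; auto; repeat constructor.
  - constructor; [lia|]. apply Forall_app; split; auto; repeat constructor.
Qed.

Ltac each_token x Hx :=
  assert (x = 0 \/ x = 1 \/ x = 2 \/ x = 3 \/ x = 4)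
    as [->|[->|[->|[->| ->]]]] by lia.

(** A complete subterm returns to its depth [k], so only the bracket closing the outermost
    abstraction meets [bot] on stack 4. *)
Lemma quote_body s : forall k c w u u2 d d2,
  runs (Goto 1) (stacks c (rev (tokens s) ++ w) u u2 (repeat tS k ++ bot :: d) d2) ->
  runs (Goto 1) (stacks (tokens s ++ c) w u u2 (repeat tS k ++ bot :: d) d2).
Proof.
  induction s as [n|s IHs t IHt|s IH]; intros k c w u u2 d d2 H; cbn [tokens] in *.
  - cbn [List.app]; macro.
    cbn [rev] in H. rewrite <- app_assoc in H. cbn [List.app] in H.
    revert H; generalize (tZ :: w); clear w.
    induction n as [|n IH]; cbn; intros w H; [exact H|].
    macro. apply IH. now rewrite <- app_assoc in H.
  - rewrite <- !app_assoc. apply IHs, IHt. cbn [List.app]. macro.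
    rewrite !rev_app_distr in H. cbn [rev List.app] in H. now rewrite <- app_assoc in H.
  - cbn [List.app] in *. rewrite <- app_assoc. macro.
    apply (IH (S k)). cbn [repeat List.app]. macro.
    cbn [rev] in H. rewrite rev_app_distr in H. cbn [rev List.app] in H.
    now rewrite <- app_assoc in H.
Qed.

Lemma quote_lam s c w u u2 d d2 :
  runs (Goto 0) (stacks c (rev (tokens (lam s)) ++ bot :: w) u u2 (bot :: d) d2) ->
  runs (Goto 0) (stacks (tokens (lam s) ++ c) w u u2 (bot :: d) d2).
Proof.
  intros H; cbn [tokens List.app]. rewrite <- app_assoc. macro.
  apply (quote_body s 0). cbn [repeat List.app]. macro.
  cbn [tokens rev] in H. rewrite rev_app_distr in H. cbn [rev List.app] in H.
  now rewrite <- app_assoc in H.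
Qed.

(** The symbol [x] stands for the closing bracket of the function, dropped before its body is read
    backwards. *)
Lemma fetch l : Forall (fun x => x < bot) l -> forall c w u u2 d d2 x, x < 7 ->
  runs (Goto 3) (stacks c w (rev l ++ u) u2 d d2) ->
  runs (Goto 2) (stacks c (l ++ bot :: x :: w) u u2 d d2).
Proof.
  induction 1 as [|y l Hy Hl IH]; intros c w u u2 d d2 x Hx H; cbn [List.app].
  - macro. exact H.
  - apply halts_goto; [lia|]. cbn [evaluator].
    eapply halts_pop; [lia| |reflexivity|rewrite upd_stacks by lia]; [lia|].
    each_token y Hy; micro; apply IH; auto; cbn [rev] in H; now rewrite <- app_assoc in H.
Qed.

Lemma copy_out l : Forall (fun x => x < bot) l -> forall c w u u2 d d2,
  runs (Goto 7) (stacks c w (bot :: u) (rev l ++ u2) d d2) ->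
  runs (Goto 6) (stacks c w (l ++ bot :: u) u2 d d2).
Proof.
  induction 1 as [|y l Hy Hl IH]; intros c w u u2 d d2 H; cbn [List.app].
  - macro. exact H.
  - apply halts_goto; [lia|]. cbn [evaluator].
    eapply halts_pop; [lia| |reflexivity|rewrite upd_stacks by lia]; [lia|].
    each_token y Hy; micro; apply IH; auto; cbn [rev] in H; now rewrite <- app_assoc in H.
Qed.

Lemma copy_in l : Forall (fun x => x < bot) l -> forall c w u u2 d d2,
  runs (Goto 3) (stacks (rev l ++ c) w (rev l ++ u) (bot :: u2) d d2) ->
  runs (Goto 7) (stacks c w u (l ++ bot :: u2) d d2).
Proof.
  induction 1 as [|y l Hy Hl IH]; intros c w u u2 d d2 H; cbn [List.app].
  - macro. exact H.
  - apply halts_goto; [lia|]. cbn [evaluator].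
    eapply halts_pop; [lia| |reflexivity|rewrite upd_stacks by lia]; [lia|].
    cbn [rev] in H; rewrite <- !app_assoc in H.
    each_token y Hy; micro; apply IH; auto.
Qed.

Lemma clear_argument l : Forall (fun x => x < bot) l -> forall c w u u2 d d2,
  runs (Goto 0) (stacks c w (bot :: u) u2 d d2) ->
  runs (Goto 8) (stacks c w (l ++ bot :: u) u2 d d2).
Proof.
  induction 1 as [|y l Hy Hl IH]; intros c w u u2 d d2 H; cbn [List.app].
  - macro. exact H.
  - apply halts_goto; [lia|]. cbn [evaluator].
    eapply halts_pop; [lia| |reflexivity|rewrite upd_stacks by lia]; [lia|].
    each_token y Hy; micro; apply IH; auto.
Qed.

Lemma restore_other j : forall m c w u u2 d d2,
  runs (Goto 3) (stacks (tZ :: c) w u u2 (repeat tS m ++ d) (bot :: d2)) ->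
  runs (Goto 4) (stacks c w u u2 d (repeat over j ++ repeat tS m ++ bot :: d2)).
Proof.
  induction j as [|j IHj]; intros m c w u u2 d d2 H; cbn [repeat List.app].
  - revert d H; induction m as [|m IH]; cbn [repeat List.app]; intros d H.
    + macro. exact H.
    + macro. apply IH.
      now rewrite app_comm_cons, repeat_cons, <- app_assoc in H.
  - macro. auto.
Qed.

Lemma restore_match m : forall c w u u2 d d2,
  runs (Goto 6) (stacks c w u u2 (repeat tS m ++ d) (bot :: d2)) ->
  runs (Goto 5) (stacks (repeat tS m ++ c) w u u2 d (repeat tS m ++ bot :: d2)).
Proof.
  induction m as [|m IH]; cbn [repeat List.app]; intros c w u u2 d d2 H.
  - macro. exact H.
  - macro. apply IH. now rewrite app_comm_cons, repeat_cons, <- app_assoc in H.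
Qed.

(** Each unit of the index consumes a unit of the depth [k], or leaves an [over] mark once the depth
    is used up. The tops of stacks 4 and 5 then tell how [n] compares with [k]. *)
Lemma read_index n : forall k c w u u2 d d2,
  runs (Goto 3) (stacks (repeat tS n ++ c) w u u2 (repeat tS (k - n) ++ bot :: d)
    (repeat over (n - k) ++ repeat tS (Nat.min n k) ++ d2)) ->
  runs (Goto 3) (stacks c (repeat tS n ++ w) u u2 (repeat tS k ++ bot :: d) d2).
Proof.
  induction n as [|n IH]; intros k c w u u2 d d2 H.
  - now rewrite Nat.sub_0_r in H.
  - cbn [repeat] in H. rewrite repeat_cons, <- app_assoc in H. cbn [repeat List.app] in *.
    destruct k as [|k]; macro; cbn [List.app repeat].
    + apply (IH 0). rewrite Nat.sub_0_r, Nat.min_0_r in *. cbn [repeat List.app] in *.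
      now rewrite app_comm_cons, repeat_cons, <- app_assoc in H.
    + apply IH. rewrite Nat.min_comm in H. cbn [Nat.sub Nat.min] in H.
      rewrite Nat.min_comm in H. cbn [repeat] in H.
      now rewrite repeat_cons, <- app_assoc in H.
Qed.

(* Reading a word backwards from stack 1 while pushing on stack 0 restores its order. *)
Lemma substitute v s : forall k c w u u2 d d2,
  runs (Goto 3) (stacks (tokens (subst s k v) ++ c) w (tokens v ++ bot :: u) (bot :: u2)
    (repeat tS k ++ bot :: d) (bot :: d2)) ->
  runs (Goto 3) (stacks c (rev (tokens s) ++ w) (tokens v ++ bot :: u) (bot :: u2)
    (repeat tS k ++ bot :: d) (bot :: d2)).
Proof.
  pose proof (tokens_bound v) as Hv.
  induction s as [n|s IHs t IHt|s IH]; intros k c w u u2 d d2 H.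
  - cbn [tokens rev]. rewrite rev_repeat, <- app_assoc.
    apply read_index. cbn [subst tokens] in H.
    (* [subst] neither shifts [v] nor renumbers other variables, so the word of [v] is copied
       verbatim and other indices are kept. *)
    destruct (Nat.eqb_spec n k) as [->|Hn].
    + rewrite Nat.sub_diag, Nat.min_id. cbn [repeat List.app].
      assert (Hgo : runs (Goto 5) (stacks (repeat tS k ++ c) w (tokens v ++ bot :: u)
          (bot :: u2) (bot :: d) (repeat tS k ++ bot :: d2))).
      { apply restore_match, copy_out, copy_in; auto.
        - now apply Forall_rev.
        - now rewrite rev_involutive. }
      destruct k as [|k]; macro; exact Hgo.
    + assert (Hgo : runs (Goto 4) (stacks (repeat tS n ++ c) w (tokens v ++ bot :: u)
          (bot :: u2) (repeat tS (k - n) ++ bot :: d)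
          (repeat over (n - k) ++ repeat tS (Nat.min n k) ++ bot :: d2))).
      { apply restore_other. rewrite app_assoc, <- repeat_app.
        replace (Nat.min n k + (k - n)) with k by lia. exact H. }
      destruct (k - n) as [|m] eqn:E1; cbn [repeat List.app] in *.
      * destruct (n - k) as [|j] eqn:E2; [lia|]. cbn [repeat List.app] in *. macro. exact Hgo.
      * macro. exact Hgo.
  - cbn [tokens]. rewrite !rev_app_distr, <- !app_assoc. cbn [rev List.app]. macro.
    apply IHt, IHs. cbn [subst tokens] in H. now rewrite <- !app_assoc in H.
  - cbn [tokens rev]. rewrite rev_app_distr, <- !app_assoc. cbn [rev List.app]. macro.
    apply (IH (S k)). cbn [repeat List.app]. macro.
    cbn [subst tokens List.app] in H. now rewrite <- app_assoc in H.
Qed.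

Lemma evaluate s r : eval s r -> forall c w,
  runs (Goto 0) (stacks c (rev (tokens r) ++ bot :: w) [bot] [bot] [bot] [bot]) ->
  runs (Goto 0) (stacks (tokens s ++ c) w [bot] [bot] [bot] [bot]).
Proof.
  induction 1 as [s|s t f v r Hs IHs Ht IHt Hr IHr]; intros c w H.
  - now apply quote_lam.
  - cbn [tokens]. rewrite <- !app_assoc. apply IHs, IHt. cbn [List.app]. macro.
    (* This exposes the outer brackets of the function: [tE] is dropped by [fetch], and [tL] at
       depth 0 ends the substitution. *)
    replace (rev (tokens (lam f)) ++ bot :: w)
      with (tE :: rev (tokens f) ++ tL :: bot :: w)
      by (cbn [tokens rev]; rewrite rev_app_distr, <- !app_assoc; reflexivity).
    pose proof (tokens_bound (lam v)) as Hv.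
    apply fetch; [now apply Forall_rev|lia|]. rewrite rev_involutive.
    apply (substitute (lam v) f 0 _ _ [] [] [] []). cbn [repeat List.app]. macro.
    apply clear_argument; auto.
Qed.

Lemma transfer l : Forall (fun x => x < bot) l -> forall c w u u2 d d2,
  runs (Goto 0) (stacks (rev l ++ c) (bot :: w) u u2 d d2) ->
  runs (Goto 9) (stacks c (l ++ bot :: w) u u2 d d2).
Proof.
  induction 1 as [|y l Hy Hl IH]; intros c w u u2 d d2 H; cbn [List.app].
  - macro. exact H.
  - apply halts_goto; [lia|]. cbn [evaluator].
    eapply halts_pop; [lia| |reflexivity|rewrite upd_stacks by lia]; [lia|].
    cbn [rev] in H; rewrite <- app_assoc in H.
    each_token y Hy; micro; apply IH; auto.
Qed.

End Evaluator.

(** Pushing in reading order makes the concept a right fold over the word; state 9 undoes the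
    reversal. *)
Fixpoint load (w : list nat) : code :=
  match w with
  | [] => Push 0 bot (Push 2 bot (Push 3 bot (Push 4 bot (Push 5 bot (Goto 9)))))
  | x :: w => Push 1 x (load w)
  end.

Lemma load_halts b l : Forall (fun x => x < 7) l -> forall w,
  halts evaluator 10 6 7 b (Goto 9) (stacks [bot] (rev l ++ w) [bot] [bot] [bot] [bot]) ->
  halts evaluator 10 6 7 b (load l) (stacks [] w [] [] [] []).
Proof.
  induction 1 as [|x l Hx Hl IH]; cbn [load]; intros w H.
  - micro. exact H.
  - micro. apply IH. cbn [rev] in H. now rewrite <- app_assoc in H.
Qed.

Definition boolean (b : bool) : term := if b then ltrue else lfalse.

Lemma evaluator_correct b s : star s (boolean b) ->
  halts evaluator 10 6 7 b (load (bot :: tokens s)) (fun _ => []).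
Proof.
  intros H.
  replace (fun _ : nat => @nil nat) with (stacks [] [] [] [] [] [])
    by (apply functional_extensionality; do 6 (intros [|i]; [reflexivity|revert i]); reflexivity).
  apply load_halts.
  - constructor; [lia|]. eapply Forall_impl; [|apply tokens_bound].
    cbn; intros; lia.
  - cbn [rev]. rewrite <- app_assoc. cbn [List.app].
    apply transfer; [apply Forall_rev, tokens_bound|]. rewrite rev_involutive.
    (* Read backwards, the result starts with two [tE]; its third letter is [tS] for [ltrue] and
       [tZ] for [lfalse]. *)
    destruct b; eapply evaluate; try (apply star_eval; exact H); cbn; macro; apply halts_stop.
Qed.

(** * Computing the concepts in L *)

Lemma star_trans s t r : star s t -> star t r -> star s r.
Proof. induction 1; eauto using star_step. Qed.

Lemma star_app_r s t t' : star t t' -> star (app s t) (app s t').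
Proof. induction 1; eauto using star_refl, star_step, stepAppR. Qed.

Definition closed (s : term) : Prop := forall k u, subst s k u = s.

Definition nil_term : term := lam (lam (var 1)).
Definition cons_term (s l : term) : term := lam (lam (app (app (var 0) s) l)).
Definition node_term (n : nat) (l : term) : term := lam (app (app (var 0) (nenc n)) l).

Fixpoint list_enc (l : list tree) : term :=
  match l with [] => nil_term | t :: l => cons_term (tenc t) (list_enc l) end.

Lemma tenc_node n l : tenc (Node n l) = node_term n (list_enc l).
Proof. reflexivity. Qed.

Lemma nenc_closed n : closed (nenc n).
Proof. induction n as [|n IH]; intros k u; cbn; [|rewrite IH]; reflexivity. Qed.

Fixpoint tenc_closed (t : tree) : closed (tenc t).
Proof.
  destruct t as [n l]; intros k u. rewrite tenc_node. cbn. rewrite nenc_closed.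
  unfold node_term; f_equal; f_equal. generalize (S k) as j.
  induction l as [|t l IH]; intros j; cbn; [reflexivity|].
  rewrite IH, tenc_closed. reflexivity.
Qed.

Lemma cenc_is_lam C : exists s, cenc C = lam s.
Proof. destruct C; cbn; eauto. Qed.

(* [p k] is the encoding of [K], with the hole occurring as the variable [k] of the surroundings. *)
Definition context (K : concept -> concept) (p : nat -> term) : Prop :=
  (forall k C, subst (p k) k (cenc C) = cenc (K C)) /\
  (forall k j u, j <> k -> subst (p k) j u = p k).

Lemma context_id : context (fun C => C) var.
Proof.
  split; intros; cbn; [now rewrite Nat.eqb_refl|].
  now rewrite (proj2 (Nat.eqb_neq k j)) by auto.
Qed.

Lemma context_neg K p : context K p -> {p' | context (fun C => CNeg (K C)) p'}.
Proof.
  intros [H1 H2].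
  (* The hole lies under one binder of [node_term] and two of [cons_term]. *)
  exists (fun k => node_term 2 (cons_term (p (S (S (S k)))) nil_term)).
  split; intros.
  - cbn. rewrite H1. reflexivity.
  - cbn. now rewrite H2 by congruence.
Qed.

Lemma context_and D K p : context K p -> {p' | context (fun C => CAnd D (K C)) p'}.
Proof.
  intros [H1 H2].
  exists (fun k => node_term 3 (cons_term (cenc D)
    (cons_term (p (S (S (S (S (S k)))))) nil_term))).
  split; intros.
  - cbn. unfold cenc in *. rewrite tenc_closed, H1. reflexivity.
  - cbn. unfold cenc in *. now rewrite tenc_closed, H2 by congruence.
Qed.

Lemma context_ex r K p : context K p -> {p' | context (fun C => CEx r (K C)) p'}.
Proof.
  intros [H1 H2].
  exists (fun k => node_term 4 (cons_term (tenc (trole r))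
    (cons_term (p (S (S (S (S (S k)))))) nil_term))).
  split; intros.
  - cbn [subst node_term cons_term nil_term Nat.eqb]. rewrite tenc_closed, H1. reflexivity.
  - cbn [subst node_term cons_term nil_term Nat.eqb]. now rewrite tenc_closed, H2 by congruence.
Qed.

Definition push_concept (x : nat) (C : concept) : concept :=
  CAnd (does true 1 x) (CAnd (CEx next_role CTop) (all_next C)).

Lemma context_push_word w K p : context K p ->
  {p' | context (fun C => fold_right push_concept (K C) w) p'}.
Proof.
  intros H. induction w as [|x w [q IH]]; cbn [fold_right]; [eauto|].
  destruct (context_neg _ _ IH) as [q1 H1].
  destruct (context_ex next_role _ _ H1) as [q2 H2].
  destruct (context_neg _ _ H2) as [q3 H3].
  destruct (context_and (CEx next_role CTop) _ _ H3) as [q4 H4].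
  exact (context_and (does true 1 x) _ _ H4).
Qed.

Lemma code_concept_load l w :
  code_concept 7 (load (l ++ w)) = fold_right push_concept (code_concept 7 (load w)) l.
Proof. induction l as [|x l IH]; cbn [List.app load code_concept fold_right]; now rewrite ?IH. Qed.

Lemma context_apply K p C : context K p -> star (app (lam (p 0)) (cenc C)) (cenc (K C)).
Proof.
  intros [H _]. destruct (cenc_is_lam C) as [s Hs].
  eapply star_step; [rewrite Hs; apply stepBeta|].
  rewrite <- Hs, H. apply star_refl.
Qed.

Lemma context_closed K p : context K p -> closed (lam (p 0)).
Proof. intros [_ H] k u; cbn; now rewrite H. Qed.

(* Church encoding of words: the letter [x] is the variable [S x], the empty word the variable 0. *)
Definition church_body (h : nat -> term) (w : list nat) : term :=
  fold_right (fun x t => app (h (S x)) t) (h 0) w.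

Definition church (w : list nat) : term :=
  lam (lam (lam (lam (lam (lam (church_body var w)))))).

(** The order descends because the outermost binder of [church] is the variable 5, that is, the
    letter 4. *)
Definition fold_term (V : term) (f : nat -> term) (e : term) : term :=
  app (app (app (app (app (app V (f 4)) (f 3)) (f 2)) (f 1)) (f 0)) e.

Lemma subst_church_body h w k u :
  subst (church_body h w) k u = church_body (fun n => subst (h n) k u) w.
Proof. unfold church_body; induction w as [|x w IH]; cbn; now rewrite ?IH. Qed.

Lemma church_body_ext h h' w : (forall n, n <= 5 -> h n = h' n) ->
  Forall (fun x => x < 5) w -> church_body h w = church_body h' w.
Proof.
  unfold church_body; intros H Hw; induction Hw as [|x w Hx Hw IH]; cbn; [apply H; lia|].
  rewrite IH, H by lia; reflexivity.
Qed.

Lemma church_fold w f e : Forall (fun x => x < 5) w ->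
  (forall x, closed (lam (f x))) ->
  star (fold_term (church w) (fun x => lam (f x)) (lam e))
    (church_body (fun n => match n with 0 => lam e | S x => lam (f x) end) w).
Proof.
  intros Hw Hf.
  assert (Hf' : forall x k u, subst (f x) (S k) u = f x)
    by (intros x k u; pose proof (Hf x k u) as E; now injection E).
  unfold fold_term, church.
  do 5 (eapply star_step; [repeat (apply stepBeta || apply stepAppL)|cbn [subst]]).
  eapply star_step; [apply stepBeta|].
  rewrite !subst_church_body.
  erewrite church_body_ext; [apply star_refl| |exact Hw].
  intros n Hn. do 6 (destruct n as [|n]; [cbn; rewrite ?Hf'; reflexivity|]). lia.
Qed.

Lemma church_fold_contexts w K p C : Forall (fun x => x < 5) w ->
  (forall x, context (K x) (p x)) ->
  star (fold_term (church w) (fun x => lam (p x 0)) (cenc C)) (cenc (fold_right K C w)).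
Proof.
  intros Hw HK. destruct (cenc_is_lam C) as [e He]. rewrite He.
  eapply star_trans; [apply church_fold; auto; intros x; eapply context_closed, HK|].
  rewrite <- He. clear Hw.
  induction w as [|x w IH]; cbn; [apply star_refl|].
  eapply star_trans; [apply star_app_r, IH|]. apply context_apply, HK.
Qed.

(** Postfix application sends all [tA] to the end, which leaves three blocks, each computable by
    folds over [w]. *)
Lemma tokens_church_body w : tokens (church_body var w) =
  flat_map (fun x => tokens (var (S x))) w ++ tokens (var 0) ++ flat_map (fun _ => [tA]) w.
Proof.
  induction w as [|x w IH]; [reflexivity|].
  cbn [church_body fold_right tokens flat_map] in *. unfold church_body in IH; rewrite IH.
  rewrite <- !app_assoc. do 3 f_equal.
  clear IH; induction w as [|y w IH]; cbn in *; congruence.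
Qed.

Lemma star_app_context K p t C : context K p -> star t (cenc C) ->
  star (app (lam (p 0)) t) (cenc (K C)).
Proof. intros HK Ht. eapply star_trans; [apply star_app_r, Ht|]. now apply context_apply. Qed.

Lemma star_fold_contexts w K p t C : Forall (fun x => x < 5) w ->
  (forall x, context (K x) (p x)) -> star t (cenc C) ->
  star (fold_term (church w) (fun x => lam (p x 0)) t) (cenc (fold_right K C w)).
Proof.
  intros Hw HK Ht. eapply star_trans; [apply star_app_r, Ht|]. now apply church_fold_contexts.
Qed.

Lemma fold_right_push_flat_map (f : nat -> list nat) w C :
  fold_right push_concept C (flat_map f w) =
  fold_right (fun x C => fold_right push_concept C (f x)) C w.
Proof.
  induction w as [|x w IH]; [reflexivity|].
  cbn [flat_map List.fold_right]. now rewrite fold_right_app, IH.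
Qed.

Definition machine_concept (s : term) : concept :=
  run_concept evaluator 10 6 7 (load (bot :: tokens s)).

Definition push_word_context (l : list nat) : nat -> term :=
  proj1_sig (context_push_word l _ _ context_id).

Lemma push_word_context_spec l :
  context (fun C => fold_right push_concept C l) (push_word_context l).
Proof. exact (proj2_sig (context_push_word l _ _ context_id)). Qed.

(* Kleene's recursion theorem: the word [v] of [u] and [G] determines the word of the whole term, since [church v] is spelled by a letterwise translation of [v]. *)
Lemma self_describing u : exists s, star s (cenc (machine_concept (app u s))).
Proof.
  set (inv := invariant_rules evaluator 10 6 7).
  destruct (context_push_word [bot] _ _ context_id) as [q Hq].
  destruct (context_and inv _ _ Hq) as [wrap Hwrap]; clear q Hq.
  (* The word of the whole term ends with the six closing brackets of [church v] and the two outer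
     applications. *)
  set (end_code := fold_right push_concept (code_concept 7 (load []))
    ([tE; tE; tE; tE; tE; tE] ++ [tA; tA])).
  set (word := push_word_context).
  (* From the inside out this adds the inner applications, the variables and the binders of
     [church v], and finally [v] itself. *)
  set (body := fun V => app (lam (wrap 0))
    (fold_term V (fun x => lam (word [x] 0))
    (app (lam (word [tL; tL; tL; tL; tL; tL] 0))
    (fold_term V (fun x => lam (word (tokens (var (S x))) 0))
    (app (lam (word (tokens (var 0)) 0))
    (fold_term V (fun _ => lam (word [tA] 0)) (cenc end_code))))))).
  set (G := lam (body (var 0))).
  (* [G] takes the word as its argument, so it is fixed before [v] and [v] may contain the word of
     [G]. *)
  set (v := tokens u ++ tokens G).
  assert (Hword : forall l, context (fun C => fold_right push_concept C l) (word l))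
    by exact push_word_context_spec.
  assert (Hv : Forall (fun x => x < 5) v)
    by (apply Forall_app; split; apply tokens_bound).
  exists (app G (church v)).
  eapply star_step; [apply stepBeta|].
  replace (subst (body (var 0)) 0 _) with (body (church v)).
  2:{ unfold body, fold_term, cenc. cbn [subst Nat.eqb].
      repeat rewrite (fun l j x => proj2 (Hword l) 0 (S j) x) by lia.
      rewrite (proj2 Hwrap) by lia. rewrite tenc_closed. reflexivity. }
  assert (E : machine_concept (app u (app G (church v))) =
    CAnd inv (fold_right push_concept (fold_right (fun x C => fold_right push_concept C [x])
      (fold_right push_concept
        (fold_right (fun x C => fold_right push_concept C (tokens (var (S x))))
          (fold_right push_concept
             (fold_right (fun _ C => fold_right push_concept C [tA]) end_code v)
             (tokens (var 0))) v)
        [tL; tL; tL; tL; tL; tL]) v) [bot])).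
  { unfold machine_concept, run_concept. f_equal.
    rewrite <- (app_nil_r (bot :: _)), code_concept_load.
    unfold end_code.
    rewrite <- !fold_right_push_flat_map, <- !fold_right_app. f_equal.
    cbn [tokens church]. rewrite tokens_church_body.
    replace (flat_map (fun x : nat => [x]) v) with v
      by (clear; induction v; cbn; congruence).
    unfold v. cbn [List.app]. rewrite <- !app_assoc. cbn [List.app].
    rewrite <- !app_assoc. reflexivity. }
  rewrite E. unfold body.
  apply (star_app_context _ _ _ _ Hwrap).
  apply (star_fold_contexts v _ (fun x => word [x])); auto.
  apply (star_app_context _ _ _ _ (Hword [tL; tL; tL; tL; tL; tL])).
  apply (star_fold_contexts v _ (fun x => word (tokens (var (S x))))); auto.
  apply (star_app_context _ _ _ _ (Hword (tokens (var 0)))).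
  apply (star_fold_contexts v _ (fun _ => word [tA])); auto.
  apply star_refl.
Qed.

Theorem theorem3p5 :
  ~ L_decides_on (fun _ => True) satisfiable /\
  ~ L_decides_on in_fragment satisfiable.
Proof.
  assert (H : ~ L_decides_on in_fragment satisfiable).
  { intros [u Hu]. destruct (self_describing u) as [s Hs].
    assert (Hrun : forall b, star (app u (cenc (machine_concept (app u s)))) (boolean b) ->
        halts evaluator 10 6 7 b (load (bot :: tokens (app u s))) (fun _ => [])).
    { intros b Hb. apply evaluator_correct. eapply star_trans; [apply star_app_r, Hs|exact Hb]. }
    destruct (Hu (machine_concept (app u s))) as [Hyes Hno];
      [apply run_concept_in_fragment|].
    (* Were the concept satisfiable, [u] would answer true and this very run would make it
       unsatisfiable. Hence [u] answers false, and that run yields a model. *)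
    assert (Hunsat : ~ satisfiable (machine_concept (app u s))).
    { intros Hsat. refine (halts_true_unsat _ _ _ _ _ (Hrun true (Hyes Hsat)) Hsat). }
    apply Hunsat, halts_false_sat. exact (Hrun false (Hno Hunsat)). }
  split; [|exact H].
  intros [u Hu]. apply H. exists u. auto.
Qed.
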